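(* For $s\in\{\tfrac12,1,\tfrac32,\dots\}$ let $c_2(s)$ be the best (i.e. largest) constant such that $$\Delta^2_\rho(L_1)+\Delta^2_\rho(L_3)\ \ge\ c_2(s)$$ holds for all density operators $\rho$ in the spin-$s$ representation. Then $$c_2(\tfrac12)=\tfrac14,\qquad c_2(1)=\tfrac7{16},\qquad c_2(\tfrac32)=\tfrac94+\gamma^2-\sqrt{4\gamma^2+2\gamma+1}\quad\text{where }\gamma=\cos(\pi/9).$$
   Context: The spin-$s$ representation is the irreducible $(2s+1)$-dimensional representation of $SU(2)$ on $\mathbb C^{2s+1}$, with angular momentum operators $L_1,L_2,L_3$ ($\hbar=1$, $[L_1,L_2]=iL_3$ and cyclic, $L_1^2+L_2^2+L_3^2=s(s+1)\mathbb 1$). For a density operator $\rho$ (positive semidefinite, trace 1) and a self-adjoint operator $A$, $\Delta^2_\rho(A)=\operatorname{tr}(\rho A^2)-(\operatorname{tr}\rho A)^2$. *)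

(* Defs.v *)
From mathcomp Require Import all_boot all_order all_algebra.
From mathcomp Require Import reals trigo.
From mathcomp Require Import complex.
From mathcomp Require Import ring lra zify.

Set Implicit Arguments.
Unset Strict Implicit.
Unset Printing Implicit Defensive.

Import Order.TTheory GRing.Theory Num.Theory.
Local Open Scope ring_scope.
Local Open Scope sesquilinear_scope.
Local Open Scope complex_scope.

(* Half-integer spins are indexed by n = 2s, so that s = n / 2 ranges over
   1/2, 1, 3/2, ... for n >= 1 and the space has dimension 2s + 1 = n.+1. *)
Definition spin (R : realType) (n : nat) : R := n%:R / 2.

(* Subspaces of column vectors are represented by the row space of U, hence
   the transpositions. *)
Definition irreducible_triple (R : realType) (n : nat)
    (L1 L2 L3 : 'M[R[i]]_n.+1) : Prop :=
  forall U : 'M[R[i]]_n.+1,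
    stablemx U L1^T -> stablemx U L2^T -> stablemx U L3^T ->
    U = 0 \/ row_full U.

Record spin_rep (R : realType) (n : nat) (L1 L2 L3 : 'M[R[i]]_n.+1) : Prop :=
  SpinRep {
    spin_herm1 : L1 \is hermsymmx;
    spin_herm2 : L2 \is hermsymmx;
    spin_herm3 : L3 \is hermsymmx;
    spin_comm12 : L1 * L2 - L2 * L1 = 'i%C *: L3;
    spin_comm23 : L2 * L3 - L3 * L2 = 'i%C *: L1;
    spin_comm31 : L3 * L1 - L1 * L3 = 'i%C *: L2;
    spin_casimir :
      L1 ^+ 2 + L2 ^+ 2 + L3 ^+ 2 = ((spin R n * (spin R n + 1))%:C)%:M;
    spin_irr : irreducible_triple L1 L2 L3
  }.

Definition density (R : realType) (n : nat) (rho : 'M[R[i]]_n) : Prop :=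
  [/\ rho \is hermsymmx,
      forall v : 'cV[R[i]]_n, 0 <= (v ^t* *m rho *m v) 0 0
    & \tr rho = 1].

Definition variance (R : realType) (n : nat) (rho A : 'M[R[i]]_n.+1) : R[i] :=
  \tr (rho * A ^+ 2) - (\tr (rho * A)) ^+ 2.

(* The order on R[i] is the partial one: x <= y means that y - x is real and
   nonnegative; the variances below are real since rho, L1, L3 are Hermitian. *)
Definition uncertainty_bound (R : realType) (n : nat)
    (L1 L3 : 'M[R[i]]_n.+1) (c : R) : Prop :=
  forall rho : 'M[R[i]]_n.+1, density rho ->
    c%:C <= variance rho L1 + variance rho L3.

Definition best_bound (R : realType) (n : nat)
    (L1 L3 : 'M[R[i]]_n.+1) (c : R) : Prop :=
  uncertainty_bound L1 L3 c /\
  forall c' : R, uncertainty_bound L1 L3 c' -> c' <= c.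

(* c2_is n c says c_2(n / 2) = c.  The spin-s representation is unique only up
   to unitary equivalence, hence the quantification over all realizations; one
   always exists by spin_rep_exists below. *)
Definition c2_is (R : realType) (n : nat) (c : R) : Prop :=
  forall L1 L2 L3 : 'M[R[i]]_n.+1, spin_rep L1 L2 L3 -> best_bound L1 L3 c.

Section Existence.
Variables (R : realType) (n : nat).
Local Notation C := R[i].

Let a (j : nat) : C := (j * (n.+1 - j))%:R.
Let Lp : 'M[C]_n.+1 := \matrix_(i, j) (sqrtC (a j) *+ (i.+1 == j)).
Let Lm : 'M[C]_n.+1 := \matrix_(i, j) (sqrtC (a i) *+ (j.+1 == i)).
Let D : 'rV[C]_n.+1 := \row_j (n%:R / 2 - j%:R).
Let L1 : 'M[C]_n.+1 := 2^-1 *: (Lp + Lm).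
Let L2 : 'M[C]_n.+1 := - ('i%C / 2) *: (Lp - Lm).
Let L3 : 'M[C]_n.+1 := diag_mx D.

Let ci2 : ('i%C : C) * 'i%C = -1.
Proof. by rewrite complexiE -expr2 sqrCi. Qed.

Let a_ge0 j : 0 <= a j. Proof. exact: ler0n. Qed.
Let sq j : sqrtC (a j) * sqrtC (a j) = a j.
Proof. by rewrite -expr2 sqrtCK. Qed.

Let LpLm : Lp * Lm = diag_mx (\row_j a j.+1).
Proof.
apply/matrixP => i k; rewrite !mxE.
have [ltin|leni] := ltnP i n.
  have lt : (i.+1 < n.+1)%N by [].
  rewrite (bigD1 (Ordinal lt)) //= big1 ?addr0 => [|j /negPf jE].
    rewrite !mxE /= eqxx mulr1n eqSS -val_eqE /= [nat_of_ord k == _]eq_sym.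
    by case: eqP => _; rewrite ?mulr1n ?mulr0n ?mulr0 ?sq.
  by rewrite !mxE eq_sym; move: jE; rewrite -val_eqE /= => ->; rewrite mulr0n mul0r.
rewrite big1 => [|j _].
  have -> : a i.+1 = 0 by rewrite /a subSS (eqP leni) muln0.
  by rewrite mul0rn.
by rewrite !mxE; case: eqP => [e|_]; [have := ltn_ord j; lia|rewrite mulr0n mul0r].
Qed.

Let LmLp : Lm * Lp = diag_mx (\row_j a j).
Proof.
apply/matrixP => i k; rewrite !mxE.
have [i0|igt0] := posnP i.
  rewrite big1 => [|j _]; first by rewrite i0 /a mul0n mul0rn.
  by rewrite !mxE i0 mulr0n mul0r.
have lt : (i.-1 < n.+1)%N by have := ltn_ord i; lia.
rewrite (bigD1 (Ordinal lt)) //= big1 ?addr0 => [|j /negPf jE].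
  rewrite !mxE /= prednK // eqxx mulr1n -val_eqE /=.
  by case: eqP => [<-|_]; rewrite ?mulr1n ?mulr0n ?mulr0 ?sq.
rewrite !mxE; case: eqP => [e|_]; last by rewrite mulr0n mul0r.
by move: jE; rewrite -val_eqE /= -e /= eqxx.
Qed.

Let aE j : (j <= n)%N -> a j = j%:R * (n%:R + 1 - j%:R).
Proof. by move=> le; rewrite /a natrM natrB ?leqW // -natr1. Qed.

Let aSE j : (j <= n)%N -> a j.+1 = (j%:R + 1) * (n%:R - j%:R).
Proof. by move=> le; rewrite /a subSS natrM natrB // -natr1. Qed.

Let ord_le (i : 'I_n.+1) : (i <= n)%N. Proof. by rewrite -ltnS. Qed.

Let comm_pm : Lp * Lm - Lm * Lp = 2 *: L3.
Proof.
rewrite LpLm LmLp; apply/matrixP => i k; rewrite !mxE aSE // aE //.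
case: eqP => _; rewrite ?mulr1n ?mulr0n; last by rewrite subr0 mulr0.
by field.
Qed.

Let comm_3p : L3 * Lp - Lp * L3 = Lp.
Proof.
apply/matrixP => i k; rewrite mxE [X in X + _](_ : _ = D 0 i * Lp i k); last first.
  by rewrite -[L3 * Lp]/(diag_mx D *m Lp) mul_diag_mx mxE.
rewrite mxE -[Lp * L3]/(Lp *m diag_mx D) mul_mx_diag !mxE.
by case: eqP => [<-|_]; rewrite ?mulr0n ?mulr1n; rewrite -?natr1; ring.
Qed.

Let comm_3m : L3 * Lm - Lm * L3 = - Lm.
Proof.
apply/matrixP => i k; rewrite mxE [X in X + _](_ : _ = D 0 i * Lm i k); last first.
  by rewrite -[L3 * Lm]/(diag_mx D *m Lm) mul_diag_mx mxE.
rewrite mxE -[Lm * L3]/(Lm *m diag_mx D) mul_mx_diag !mxE.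
by case: eqP => [<-|_]; rewrite ?mulr0n ?mulr1n; rewrite -?natr1; ring.
Qed.

Let a_neq0 j : (0 < j <= n)%N -> sqrtC (a j) != 0.
Proof. by move=> jP; rewrite sqrtC_eq0 /a pnatr_eq0 muln_eq0; lia. Qed.

Let stable_tr (F : fieldType) m (U A B : 'M[F]_m) c :
  stablemx U A^T -> stablemx U B^T -> stablemx U (A + c *: B)^T.
Proof.
move=> sA sB; rewrite linearD linearZ /= mulmxDr -scalemxAr.
by rewrite addmx_sub // scalemx_sub.
Qed.

Let irr : irreducible_triple L1 L2 L3.
Proof.
move=> U s1 s2 _.
have Cp : Lp = L1 + 'i%C *: L2.
  rewrite /L1 /L2 scalerA mulrN mulrA ci2 mulN1r opprK -scalerDr.
  by rewrite addrACA subrr addr0 scalerDr -scalerDl -[LHS]scale1r; congr (_ *: _); field.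
have Cm : Lm = L1 - 'i%C *: L2.
  rewrite /L1 /L2 scalerA mulrN mulrA ci2 mulN1r opprK -scalerBr.
  by rewrite opprB addrC addrA subrK scalerDr -scalerDl -[LHS]scale1r; congr (_ *: _); field.
have sp : stablemx U Lp^T.
  by move: s1 s2 Cp; clearbody L1 L2 Lp => s1 s2 ->; apply: stable_tr.
have sm : stablemx U Lm^T.
  by move: s1 s2 Cm; clearbody L1 L2 Lm => s1 s2 ->; rewrite -scaleNr; apply: stable_tr.
have [->|U0] := eqVneq U 0; [by left|right].
have up (v : 'rV[C]_n.+1) (j : 'I_n.+1) : (v *m Lp^T) 0 j =
    \sum_k v 0 k * (sqrtC (a k) *+ (j.+1 == k)).
  by rewrite mxE; apply: eq_bigr => k _; rewrite !mxE.
have st (v : 'rV[C]_n.+1) M : stablemx U M -> (v <= U)%MS -> (v *m M <= U)%MS.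
  by move=> sM vU; rewrite (submx_trans _ sM) // submxMr.
have top k : forall v : 'rV[C]_n.+1, (v <= U)%MS -> (forall ltk : (k < n.+1)%N,
    v 0 (Ordinal ltk) != 0) -> (k < n.+1)%N ->
    (forall j : 'I_n.+1, (k < j)%N -> v 0 j = 0) -> ((delta_mx 0 0 : 'rV[C]_n.+1) <= U)%MS.
  elim: k => [|k IH] v vU v0 ltk vz.
    have -> : delta_mx 0 0 = (v 0 (Ordinal ltk))^-1 *: v :> 'rV[C]_n.+1.
      apply/rowP => j; rewrite !mxE eqxx /=.
      have [->|jn0] := eqVneq j 0.
        by rewrite (_ : 0 = Ordinal ltk) ?mulVf //; apply: val_inj.
      by rewrite [v 0 j]vz ?mulr0 // lt0n.
    exact: scalemx_sub.
  apply: (IH (v *m Lp^T)); [exact: st| |exact: ltnW|] => [ltk'|j ltj].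
    rewrite up (bigD1 (Ordinal ltk)) //= big1 => [|j /negPf jE].
      by rewrite eqxx mulr1n addr0 mulf_neq0 // a_neq0 //; lia.
    by rewrite eq_sym; move: jE; rewrite -val_eqE /= => ->; rewrite mulr0n mulr0.
  rewrite up big1 // => i _; case: eqP => [e|]; last by rewrite mulr0n mulr0.
  by rewrite vz ?mul0r //; lia.
have e0U : ((delta_mx 0 0 : 'rV[C]_n.+1) <= U)%MS.
  have [v vU /rV0Pn[k0 vk0]] := rowV0Pn U0.
  case: (@arg_maxnP _ k0 (fun k => v 0 k != 0) (fun k : 'I_n.+1 => k : nat) vk0).
  move=> k vk kmax; apply: (top k v) => //.
    by move=> lt; rewrite (_ : Ordinal lt = k) //; apply: val_inj.
  by move=> j ltkj; apply/eqP; apply: contraLR ltkj => /kmax; rewrite -leqNgt.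
have eU k : forall ltk : (k < n.+1)%N,
    ((delta_mx 0 (Ordinal ltk) : 'rV[C]_n.+1) <= U)%MS.
  elim: k => [|k IH] ltk.
    by rewrite (_ : Ordinal ltk = 0) //; apply: val_inj.
  have ltk' := ltnW ltk; have := st _ _ sm (IH ltk').
  rewrite -rowE => /(scalemx_sub (sqrtC (a k.+1))^-1); congr (_ <= U)%MS.
  apply/rowP => j; rewrite !mxE eqxx /= eq_sym -val_eqE /= eq_sym.
  by case: eqP => [<-|_]; rewrite ?mulr0n ?mulr0 // mulr1n mulVf // a_neq0 //; lia.
rewrite -sub1mx; apply/row_subP => i; rewrite row1.
by case: i => k ltk; apply: eU.
Qed.

Let Lp_adj : Lp ^t* = Lm.
Proof.
apply/matrixP => i j; rewrite !mxE rmorphMn /= conj_Creal //.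
by apply: ger0_real; rewrite sqrtC_ge0.
Qed.

Let Lm_adj : Lm ^t* = Lp.
Proof. by rewrite -Lp_adj; apply/matrixP=> i j; rewrite !mxE conjCK. Qed.

Let hermE (A : 'M[C]_n.+1) : A ^t* = A -> A \is hermsymmx.
Proof. by move=> AE; apply/is_hermitianmxP; rewrite expr0 scale1r AE. Qed.

Let adjD (A B : 'M[C]_n.+1) : (A + B) ^t* = A ^t* + B ^t*.
Proof. by apply/matrixP => i j; rewrite !mxE rmorphD. Qed.

Let adjZ c (A : 'M[C]_n.+1) : (c *: A) ^t* = c^* *: (A ^t* ).
Proof. by apply/matrixP => i j; rewrite !mxE rmorphM. Qed.

Let commZ c d (A B : 'M[C]_n.+1) :
  (c *: A) * (d *: B) - (d *: B) * (c *: A) = (c * d) *: (A * B - B * A).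
Proof.
by rewrite -!scalerAl -!scalerAr !scalerA [d * c]mulrC scalerBr.
Qed.

Let commD (A B M : 'M[C]_n.+1) :
  M * (A + B) - (A + B) * M = (M * A - A * M) + (M * B - B * M).
Proof. by rewrite mulrDr mulrDl opprD addrACA. Qed.

Let commN (A M : 'M[C]_n.+1) : M * - A - - A * M = - (M * A - A * M).
Proof. by rewrite mulrN mulNr opprD. Qed.

Let c31 : L3 * L1 - L1 * L3 = 'i%C *: L2.
Proof.
rewrite -[X in X * L1]scale1r -[X in L1 * X]scale1r /L1 commZ commD comm_3p comm_3m.
by rewrite mul1r /L2 scalerA mulrN mulrA ci2 mulN1r opprK.
Qed.

Let c23 : L2 * L3 - L3 * L2 = 'i%C *: L1.
Proof.
apply: oppr_inj; rewrite opprB.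
rewrite -[X in X * L2]scale1r -[X in L2 * X]scale1r /L2 commZ commD commN comm_3p comm_3m.
by rewrite mul1r opprK scalerA scaleNr.
Qed.

Let c12 : L1 * L2 - L2 * L1 = 'i%C *: L3.
Proof.
rewrite /L1 /L2 commZ commD commN.
have e : (Lp + Lm) * Lp - Lp * (Lp + Lm) = - (2 *: L3).
  by rewrite -opprB commD subrr add0r comm_pm.
have e' : (Lp + Lm) * Lm - Lm * (Lp + Lm) = 2 *: L3.
  by rewrite -opprB commD subrr addr0 -opprB opprK comm_pm.
by rewrite e e' -opprD -scalerDl -scaleNr scalerA; congr (_ *: _); field.
Qed.

Let cas : L1 ^+ 2 + L2 ^+ 2 + L3 ^+ 2 = ((spin R n * (spin R n + 1))%:C)%:M.
Proof.
have -> : L1 ^+ 2 + L2 ^+ 2 = 2^-1 *: (Lp * Lm + Lm * Lp).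
  rewrite !exprZn.
  have -> : (- ('i%C / 2)) ^+ 2 = - (2^-1 ^+ 2) :> C.
    by rewrite sqrrN exprMn [_ ^+ 2]ci2 mulN1r.
  rewrite scaleNr -scalerBr.
  have -> : (Lp + Lm) ^+ 2 - (Lp - Lm) ^+ 2 = 2 *: (Lp * Lm + Lm * Lp).
    have -> : (Lp + Lm) ^+ 2 = (Lp * Lp + Lm * Lm) + (Lp * Lm + Lm * Lp).
      by rewrite expr2 mulrDl !mulrDr [Lm * Lp + _]addrC addrACA.
    have -> : (Lp - Lm) ^+ 2 = (Lp * Lp + Lm * Lm) - (Lp * Lm + Lm * Lp).
      rewrite expr2 mulrDl !mulrDr mulrNN !mulrN !mulNr.
      by rewrite [- (Lm * Lp) + _]addrC addrACA -opprD.
    by rewrite opprB addrC addrA subrK scaler_nat.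
  by rewrite scalerA; congr (_ *: _); field.
rewrite LpLm LmLp expr2 -[L3 * L3]/(diag_mx D *m diag_mx D) mulmx_diag.
apply/matrixP => i k; rewrite !mxE aSE // aE //.
case: eqP => _; rewrite ?mulr0n ?mulr1n; last by rewrite !addr0 mulr0.
by rewrite /spin rmorphM rmorphD rmorph1 /= fmorph_div /= !rmorph_nat; field.
Qed.

Let herm3 : L3 ^t* = L3.
Proof.
apply/matrixP => i j; rewrite !mxE rmorphMn rmorphB fmorph_div /= !rmorph_nat.
by rewrite eq_sym; case: eqP => [->|].
Qed.

Lemma spin_rep_exists : exists L1 L2 L3 : 'M[C]_n.+1, spin_rep L1 L2 L3.
Proof.
exists L1, L2, L3; split.
- apply: hermE; rewrite adjZ adjD Lp_adj Lm_adj [Lm + _]addrC; congr (_ *: _).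
  by rewrite fmorphV rmorph_nat.
- apply: hermE; rewrite adjZ -[Lp - Lm]/(Lp + - Lm) adjD.
  rewrite -[- Lm]scaleN1r adjZ Lp_adj Lm_adj rmorphN1 scaleN1r -[Lm - Lp]opprB.
  rewrite scalerN -scaleNr; congr (_ *: _).
  by rewrite complexiE rmorphN opprK fmorph_div rmorph_nat /= conjCi mulNr.
- exact: hermE.
- exact: c12.
- exact: c23.
- exact: c31.
- exact: cas.
- exact: irr.
Qed.
End Existence.

(* Main.v *)
Require Import Defs.
From mathcomp Require Import all_boot all_order all_algebra.
From mathcomp Require Import reals trigo.
From mathcomp Require Import complex.
From mathcomp Require Import ring lra zify.

(** Quantize along axis 2: in the orthonormal basis e_0, ..., e_n of eigenvectors
    of L2 with eigenvalues s, s - 1, ..., -s, the operator L1^2 + L3^2 is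
    diagonal and L3 + i L1 is the raising operator.  With sigma the matrix of rho
    in this basis, the sum of the variances is a linear function of the diagonal
    of sigma minus |tr (rho (L3 + i L1))|^2, a trace which only involves the
    entries next to the diagonal.  Since |sigma_ij|^2 <= sigma_ii sigma_jj,
    replacing sigma by the pure state with real amplitudes x_j = sqrt sigma_jj
    can only decrease it, so c_2(s) is the minimum of a quartic form on the unit
    sphere.  For s = 3/2 a further Cauchy-Schwarz step leaves two amplitudes and
    a pencil of binary quadratic forms in a parameter l; at the claimed value
    the determinant is a square times a positive factor, because of the cubic
    equation satisfied by 2 cos (pi / 9). *)

Set Implicit Arguments.
Unset Strict Implicit.
Unset Printing Implicit Defensive.

Import Order.TTheory GRing.Theory Num.Theory.
Local Open Scope ring_scope.
Local Open Scope sesquilinear_scope.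
Local Open Scope complex_scope.

(** * Conjugate transposes, vector norms and sesquilinear forms *)

Section Adjoint.
Variable C : numClosedFieldType.

Lemma adjmxM m n p (A : 'M[C]_(m, n)) (B : 'M[C]_(n, p)) :
  (A *m B) ^t* = B ^t* *m A ^t*.
Proof. by rewrite trmx_mul map_mxM. Qed.

Lemma adjmxD m n (A B : 'M[C]_(m, n)) : (A + B) ^t* = A ^t* + B ^t*.
Proof. by rewrite linearD /= map_mxD. Qed.

Lemma adjmxZ m n c (A : 'M[C]_(m, n)) : (c *: A) ^t* = c^* *: A ^t*.
Proof. by rewrite linearZ /= map_mxZ. Qed.

Lemma hermsymmxP n (A : 'M[C]_n) : reflect (A ^t* = A) (A \is hermsymmx).
Proof.
apply: (iffP (is_hermitianmxP _ _ _)); rewrite expr0 scale1r => H.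
  exact: esym.
by rewrite H.
Qed.

Lemma adjmx_mul_ge0 n (v : 'cV[C]_n) : 0 <= (v ^t* *m v) 0 0.
Proof.
by rewrite mxE sumr_ge0 // => i _; rewrite !mxE mulrC mul_conjC_ge0.
Qed.

Lemma adjmx_mul_eq0 n (v : 'cV[C]_n) : ((v ^t* *m v) 0 0 == 0) = (v == 0).
Proof.
apply/eqP/eqP => [|->]; last by rewrite mulmx0 mxE.
rewrite mxE => /psumr_eq0P H; apply/matrixP => i j; rewrite ord1 mxE.
apply/eqP; rewrite -mul_conjC_eq0 mulrC; apply/eqP.
have := H _ i; rewrite !mxE; apply => // k _.
by rewrite !mxE mulrC mul_conjC_ge0.
Qed.

Lemma mxtrace_hermsym_real n (A B : 'M[C]_n) :
  A ^t* = A -> B ^t* = B -> \tr (A *m B) \is Num.real.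
Proof.
move=> hA hB; apply/CrealP.
rewrite -[LHS]trace_map_mx -[LHS]mxtrace_tr map_trmx.
by rewrite -/((A *m B) ^t*) adjmxM hA hB mxtrace_mulC.
Qed.

(** Test vectors supported on two coordinates are all that is needed to bound the entries of a
    density matrix. *)
Lemma sesqui_delta n (A : 'M[C]_n) i j (x y : C) :
  let v : 'cV[C]_n := x *: delta_mx i 0 + y *: delta_mx j 0 in
  (v ^t* *m A *m v) 0 0 =
    x^* * x * A i i + x^* * y * A i j + y^* * x * A j i + y^* * y * A j j.
Proof.
have adjE k : (delta_mx k 0 : 'cV[C]_n) ^t* = delta_mx 0 k.
  by apply/matrixP => a b; rewrite !mxE rmorph_nat andbC.
have mulE k l : delta_mx 0 k *m A *m delta_mx l 0 = (A k l)%:M :> 'M_1.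
  by rewrite -rowE -colE; apply/matrixP => a b; rewrite !ord1 !mxE mulr1n.
rewrite /= adjmxD !adjmxZ !adjE.
rewrite mulmxDl -!scalemxAl mulmxDr !mulmxDl -!scalemxAr -!scalemxAl !mulE.
by rewrite !mxE !mulr1n; ring.
Qed.

End Adjoint.

(** * Ladder coefficients and the quartic form to be minimized *)

Section LadderCoefficients.
Variables (R : realType) (n : nat).

(* The raising operator sends e_j to [ladder_coef j] e_(j-1): with s = n / 2 and
   m = s - j one has s (s + 1) - m (m + 1) = j (n + 1 - j). *)
Definition ladder_coef (j : nat) : R := Num.sqrt (j * (n.+1 - j))%:R.

Definition raising_mx : 'M[R[i]]_n.+1 :=
  \matrix_(i, j) ((ladder_coef j)%:C *+ (i.+1 == j)).

(* This is s (s + 1) - (s - j)^2, the eigenvalue of L1^2 + L3^2 at e_j. *)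
Definition planar_weight (j : nat) : R := n%:R / 2 + n%:R * j%:R - j%:R ^+ 2.

(** This is the sum of the two variances in the pure state with real amplitudes [x j] in the weight
    basis. *)
Definition planar_energy (x : nat -> R) : R :=
  \sum_(j < n.+1) planar_weight j * x j ^+ 2
    - (\sum_(j < n) ladder_coef j.+1 * (x j * x j.+1)) ^+ 2.

End LadderCoefficients.

(** * Angular momentum algebra and the weight basis of [Z] *)

Section Ladder.
Variables (R : realType) (n : nat).
Local Notation C := R[i].
Variables X Y Z : 'M[C]_n.+1.
Hypotheses (hX : X ^t* = X) (hY : Y ^t* = Y) (hZ : Z ^t* = Z).
Hypotheses (cXY : X * Y - Y * X = 'i%C *: Z)
  (cYZ : Y * Z - Z * Y = 'i%C *: X) (cZX : Z * X - X * Z = 'i%C *: Y).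
Let s : C := (spin R n)%:C.
Hypothesis cas : X ^+ 2 + Y ^+ 2 + Z ^+ 2 = (s * (s + 1))%:M.

Definition raising : 'M[C]_n.+1 := X + 'i%C *: Y.
Definition lowering : 'M[C]_n.+1 := X - 'i%C *: Y.
Local Notation Lp := raising.
Local Notation Lm := lowering.

Lemma mulii : ('i%C : C) * 'i%C = -1.
Proof. by rewrite -expr2 sqr_i. Qed.

Lemma conji : ('i%C : C)^*%R = - 'i%C.
Proof. by rewrite complexiE conjCi. Qed.

Lemma adj_raising : Lp ^t* = Lm.
Proof. by rewrite adjmxD adjmxZ hX hY conji scaleNr. Qed.

Lemma adj_lowering : Lm ^t* = Lp.
Proof. by rewrite -adj_raising trmxCK. Qed.

Lemma planar_casimir : X ^+ 2 + Y ^+ 2 = (s * (s + 1))%:M - Z ^+ 2.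
Proof. by rewrite -cas addrK. Qed.

Lemma lowering_raising : Lm * Lp = (s * (s + 1))%:M - Z ^+ 2 - Z.
Proof.
rewrite -planar_casimir /raising /lowering mulrDl !mulrDr mulNr mulNr.
rewrite -!scalerAl -!scalerAr scalerA mulii scaleN1r opprK.
rewrite [LHS](_ : _ = X * X + Y * Y + 'i%C *: (X * Y - Y * X)).
  by rewrite cXY scalerA mulii scaleN1r !expr2.
by rewrite scalerBr [in LHS]addrA (AC (3*1) ((1*4)*(2*3)))/=.
Qed.

Lemma raising_lowering : Lp * Lm = (s * (s + 1))%:M - Z ^+ 2 + Z.
Proof.
rewrite -planar_casimir /raising /lowering mulrDl !mulrDr mulrN mulrN.
rewrite -!scalerAl -!scalerAr scalerA mulii scaleN1r opprK.
rewrite [LHS](_ : _ = X * X + Y * Y - 'i%C *: (X * Y - Y * X)).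
  by rewrite cXY scalerA mulii scaleN1r opprK !expr2.
by rewrite scalerBr opprB [in LHS]addrA (AC (3*1) ((1*4)*(3*2)))/=.
Qed.

Lemma comm_raising : Z * Lp - Lp * Z = Lp.
Proof.
rewrite /raising mulrDr mulrDl opprD addrACA cZX -scalerAr -scalerAl -scalerBr.
by rewrite -opprB cYZ scalerN scalerA mulii scaleN1r opprK addrC.
Qed.

Lemma comm_lowering : Z * Lm - Lm * Z = - Lm.
Proof.
have := congr1 (fun A => A ^t*) comm_raising.
by rewrite linearB map_mxB !adjmxM adj_raising hZ => /(congr1 -%R); rewrite opprB.
Qed.

(* If [raising] were invertible, comm_raising would read
   [Z - Lp * Z * Lp^-1 = 1], whose two sides have traces 0 and n + 1. *)
Lemma raising_singular : Lp \notin unitmx.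
Proof.
apply/negP => u; have := congr1 (fun A => \tr (A *m invmx Lp)) comm_raising.
rewrite mulmxV // mxtrace1 mulmxBl linearB /= -[Z * Lp]/(Z *m Lp) mulmxK //.
rewrite -[Lp * Z]/(Lp *m Z) -mulmxA mxtrace_mulC mulmxKV // subrr.
by move/esym/eqP; rewrite pnatr_eq0.
Qed.

Lemma highest_vector :
  exists v : 'cV[C]_n.+1, [/\ (v ^t* *m v) 0 0 = 1, Z *m v = s *: v & Lp *m v = 0].
Proof.
have eigen (c : C) : \det (Z - c%:M) = 0 -> exists2 v : 'cV_n.+1, v != 0 & Z *m v = c *: v.
  move=> d0; have /eqP/det0P[v v0 vE] : \det (Z - c%:M)^T = 0 by rewrite det_tr.
  exists v^T; first by rewrite trmx_eq0.
  apply/eqP; rewrite -subr_eq0 -mul_scalar_mx -mulmxBl -[_ - _]trmxK -trmx_mul.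
  by rewrite vE trmx0.
have sE : s = n%:R / 2 by rewrite /s /spin fmorph_div /= !rmorph_nat.
(* The product below is - Lm * Lp, hence singular; the eigenvalue -(s + 1) is
   excluded because it would make the norm of Lm v negative. *)
have : \det ((Z - s%:M) * (Z - (- (s + 1))%:M)) = 0.
  have -> : (Z - s%:M) * (Z - (- (s + 1))%:M) = - (Lm * Lp).
    rewrite lowering_raising raddfN opprK mulrBl !mulrDr.
    rewrite -[s%:M * Z]/(s%:M *m Z) -[Z * (s + 1)%:M]/(Z *m _) mul_scalar_mx mul_mx_scalar.
    rewrite -[s%:M * _]/(s%:M *m _) -scalar_mxM scalerDl scale1r.
    rewrite expr2 !opprD !opprK -mulrDr (AC (1*2*2) ((5*1*3)*(2*4))) /=.
    by rewrite subrr addr0.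
  rewrite -scaleN1r detZ detM.
  have := raising_singular; rewrite unitmxE unitfE negbK => /eqP ->.
  by rewrite !mulr0.
rewrite detM => /eqP; rewrite mulf_eq0 => /orP[] /eqP /eigen[v v0 vE].
  set N := (v ^t* *m v) 0 0.
  have N0 : 0 < N by rewrite lt_def adjmx_mul_ge0 adjmx_mul_eq0 v0.
  (* The squared norm of [Lp *m v] is (s (s + 1) - s^2 - s) N = 0. *)
  have Lpv : Lp *m v = 0.
    apply/eqP; rewrite -adjmx_mul_eq0 adjmxM adj_raising -mulmxA [Lm *m _]mulmxA.
    rewrite [Lm *m Lp]lowering_raising !mulmxBl mul_scalar_mx -[Z ^+ 2]/(Z *m Z) -mulmxA vE.
    by rewrite -scalemxAr vE scalerA -!scalerBl -scalemxAr mxE; apply/eqP; ring.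
  have rN : ((sqrtC N)^-1)^*%R = (sqrtC N)^-1.
    by apply/CrealP/ger0_real; rewrite invr_ge0 sqrtC_ge0 ltW.
  exists ((sqrtC N)^-1 *: v); split; rewrite -?scalemxAr ?vE ?Lpv ?scaler0 //; last first.
    by rewrite !scalerA mulrC.
  rewrite adjmxZ -scalemxAl mxE [X in _ * X]mxE -/N rN mulrA -expr2 exprVn sqrtCK.
  by rewrite mulVf // gt_eqF.
suff H : (Lm *m v) ^t* *m (Lm *m v) = - (2 * (s + 1)) *: (v ^t* *m v).
  exfalso; move: H => /matrixP /(_ 0 0); rewrite [in RHS]mxE => {}H.
  have := adjmx_mul_ge0 (Lm *m v); rewrite H mulNr oppr_ge0 => /le_gtF/negbT/negP; apply.
  apply: mulr_gt0.
    by rewrite mulr_gt0 // sE ltr_wpDl // divr_ge0 // ler0n.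
  by rewrite lt_def adjmx_mul_ge0 adjmx_mul_eq0 v0.
rewrite adjmxM adj_lowering -mulmxA [Lp *m _]mulmxA.
rewrite [Lp *m Lm]raising_lowering mulmxDl mulmxBl mul_scalar_mx -[Z ^+ 2]/(Z *m Z) -mulmxA vE.
by rewrite -scalemxAr vE scalerA -scalerBl -scalerDl -scalemxAr; congr (_ *: _); ring.
Qed.

Section WeightVectors.
Variable v : 'cV[C]_n.+1.
Hypotheses (v1 : (v ^t* *m v) 0 0 = 1) (Zv : Z *m v = s *: v) (Lpv : Lp *m v = 0).

(** Dividing by the ladder coefficient keeps the norm equal to 1 up to index [n]. At n + 1 the
    coefficient is 0, hence so is its inverse, and the vectors vanish from there on. *)
Fixpoint weight_vector (k : nat) : 'cV[C]_n.+1 :=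
  if k is k'.+1 then ((ladder_coef R n k)%:C)^-1 *: (Lm *m weight_vector k') else v.
Local Notation e := weight_vector.

Lemma mulmx_weight_vector k : Z *m e k = (s - k%:R) *: e k.
Proof.
elim: k => [|k IH]; first by rewrite subr0.
rewrite /= -scalemxAr mulmxA.
have -> : Z *m Lm = Lm *m Z - Lm.
  by rewrite -[- Lm]comm_lowering addrC [X in _ = X]subrK.
rewrite mulmxBl -mulmxA IH -scalemxAr -[X in _ - X]scale1r -scalerBl !scalerA mulrC -natr1.
by congr (_ *: _); ring.
Qed.

(** The right side is the value that [raising_lowering] gives to [Lp * Lm] at the eigenvalue s - k
    of [Z]. *)
Lemma ladder_coef_sq k : (k < n)%N ->
  (ladder_coef R n k.+1)%:C ^+ 2 = s * (s + 1) - (s - k%:R) ^+ 2 + (s - k%:R) :> C.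
Proof.
move=> ltkn; rewrite -rmorphXn /= sqr_sqrtr ?ler0n // rmorph_nat subSS natrM natrB;
  last exact: ltnW.
by rewrite /s /spin fmorph_div /= !rmorph_nat -natr1; field.
Qed.

Lemma ladder_coef_neq0 k : (k < n)%N -> (ladder_coef R n k.+1)%:C != 0 :> C.
Proof.
move=> ltkn; rewrite fmorph_eq0 gt_eqF // sqrtr_gt0 ltr0n muln_gt0 /=.
by rewrite subSS subn_gt0.
Qed.

Lemma raising_lowering_weight_vector k : (k < n)%N ->
  Lp *m (Lm *m e k) = (ladder_coef R n k.+1)%:C ^+ 2 *: e k.
Proof.
move=> ltkn; rewrite ladder_coef_sq // mulmxA [Lp *m Lm]raising_lowering.
rewrite mulmxDl mulmxBl mul_scalar_mx -[Z ^+ 2]/(Z *m Z) -mulmxA !mulmx_weight_vector.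
by rewrite -scalemxAr mulmx_weight_vector scalerA -scalerBl -scalerDl expr2.
Qed.

Lemma raising_weight_vector k : (k < n)%N ->
  Lp *m e k.+1 = (ladder_coef R n k.+1)%:C *: e k.
Proof.
move=> ltkn; rewrite /= -scalemxAr raising_lowering_weight_vector // scalerA.
by rewrite expr2 mulKf // ladder_coef_neq0.
Qed.

Lemma weight_vector_norm k : (k <= n)%N -> (e k) ^t* *m e k = 1%:M.
Proof.
elim: k => [|k IH] ltkn; first by rewrite [LHS]mx11_scalar v1.
rewrite [X in X ^t* *m _]/= adjmxZ adjmxM adj_lowering -scalemxAl -mulmxA.
rewrite raising_weight_vector // -scalemxAr IH 1?ltnW // scalerA.
have -> : (((ladder_coef R n k.+1)%:C)^-1)^*%R = ((ladder_coef R n k.+1)%:C)^-1 :> C.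
  by apply/CrealP/ger0_real; rewrite invr_ge0 ler0c sqrtr_ge0.
by rewrite mulVf ?scale1r // ladder_coef_neq0.
Qed.

(** The Hermitian matrix [Z] has the distinct real eigenvalues s - j and s - k on these two
    vectors. *)
Lemma weight_vector_orth j k : j != k -> (e j) ^t* *m e k = 0.
Proof.
move=> nejk; apply: (scalerI (a := (j%:R - k%:R : C))).
  by rewrite subr_eq0 eqr_nat.
have := congr1 (mulmx ((e j) ^t*)) (mulmx_weight_vector k).
rewrite mulmxA -[X in _ *m X *m _]hZ -adjmxM mulmx_weight_vector adjmxZ.
have -> : (s - j%:R)^*%R = s - j%:R.
  by apply/CrealP; rewrite rpredB ?realn //; apply/complex_realP; exists (spin R n).
rewrite -scalemxAl -scalemxAr => /eqP; rewrite -subr_eq0 -scalerBl => /eqP H.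
by rewrite scaler0 -[RHS]oppr0 -H -scaleNr; congr (_ *: _); ring.
Qed.

End WeightVectors.

Lemma weight_basis : exists P : 'M[C]_n.+1, [/\ P ^t* *m P = 1%:M,
  Z *m P = P *m diag_mx (\row_j (s - j%:R)) & Lp *m P = P *m raising_mx R n].
Proof.
have [v [v1 Zv Lpv]] := highest_vector.
pose P : 'M[C]_n.+1 := \matrix_(i, j) weight_vector v j i 0.
have colPE j : col j P = weight_vector v j.
  by apply/colP => i; rewrite !mxE.
have colAP (A : 'M_n.+1) j : col j (A *m P) = A *m weight_vector v j.
  by rewrite colE -mulmxA -colE colPE.
exists P; split.
- apply/matrixP => i j; rewrite !mxE.
  have -> : \sum_k P ^t* i k * P k j = ((weight_vector v i) ^t* *m weight_vector v j) 0 0.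
    by rewrite mxE; apply: eq_bigr => k _; rewrite !mxE.
  have [<-|neij] := eqVneq i j; first by rewrite weight_vector_norm // ?mxE // -ltnS.
  by rewrite weight_vector_orth // mxE.
- apply/matrixP => i j; rewrite mul_mx_diag.
  have /colP/(_ i) := colAP Z j; rewrite [LHS]mxE => ->.
  by rewrite mulmx_weight_vector // !mxE mulrC.
apply/matrixP => i j; have /colP/(_ i) := colAP Lp j; rewrite [LHS]mxE => ->.
rewrite [RHS]mxE; case: j => -[|k] ltk /=.
  by rewrite Lpv mxE big1 // => j _; rewrite !mxE mulr0n mulr0.
rewrite -/(weight_vector v k.+1) raising_weight_vector // [LHS]mxE.
rewrite (bigD1 (Ordinal (ltnW ltk))) //= big1 => [|j /negPf jE].
  by rewrite !mxE /= eqxx addr0 mulr1n mulrC.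
by rewrite !mxE /= eqSS; move: jE; rewrite -val_eqE /= => ->; rewrite mulr0n mulr0.
Qed.

(** The means x and y of [X] and [Y] are real, so x^2 + y^2 = |x + i y|^2 is the squared modulus of
    tr (rho Lp). By the Casimir relation X^2 + Y^2 is diagonal in the weight basis. *)
Lemma planar_variance_weight_basis (P rho : 'M[C]_n.+1) :
  P ^t* *m P = 1%:M -> Z *m P = P *m diag_mx (\row_j (s - j%:R)) ->
  Lp *m P = P *m raising_mx R n -> rho ^t* = rho ->
  let sigma := P ^t* *m rho *m P in
  variance rho X + variance rho Y =
    \sum_(j < n.+1) (planar_weight R n j)%:C * sigma j j
      - `|\sum_(j < n) (ladder_coef R n j.+1)%:C * sigma (inord j) (inord j.+1)| ^+ 2.
Proof.
move=> P1 ZP LpP hrho sigma.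
have PP : P *m P ^t* = 1%:M by apply: mulmx1C.
have trP A B : A *m P = P *m B -> \tr (rho *m A) = \tr (sigma *m B).
  move=> AP; rewrite -[A]mulmx1 -PP [A *m _]mulmxA AP mulmxA mxtrace_mulC.
  by rewrite /sigma !mulmxA.
have hsigma : sigma ^t* = sigma by rewrite /sigma !adjmxM trmxCK hrho mulmxA.
clearbody sigma.
have tr2 : \tr (rho *m (X ^+ 2 + Y ^+ 2)) = \sum_(j < n.+1) (planar_weight R n j)%:C * sigma j j.
  rewrite planar_casimir (trP _ (diag_mx (\row_j (planar_weight R n j)%:C))).
    by apply: eq_bigr => j _; rewrite mul_mx_diag !mxE mulrC.
  rewrite mulmxBl -[Z ^+ 2]/(Z *m Z) -mulmxA ZP mulmxA ZP -mulmxA mulmx_diag.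
  rewrite mul_scalar_mx -mul_mx_scalar -mulmxBr; congr (_ *m _).
  apply/matrixP => i j; rewrite !mxE; case: eqP => _; rewrite ?mulr0n ?mulr1n ?subr0 //.
  rewrite /planar_weight /s /spin rmorphB rmorphD rmorphXn !rmorphM fmorphV /= !rmorph_nat.
  by field.
(* [raising_mx] selects the entries of [sigma] at (j + 1, j), conjugate to those at (j, j + 1)
   because [sigma] is Hermitian. *)
have tr1 : \tr (rho *m Lp) =
    (\sum_(j < n) (ladder_coef R n j.+1)%:C * sigma (inord j) (inord j.+1))^*%R.
  rewrite (trP _ _ LpP) /mxtrace big_ord_recl !mxE big1 ?add0r; last first.
    by move=> j _; rewrite !mxE mulr0n mulr0.
  rewrite rmorph_sum; apply: eq_bigr => j _ /=.
  have e1 : lift ord0 j = inord j.+1.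
    by apply: val_inj; rewrite [RHS]inordK ?lift0 // ltnS.
  rewrite mxE (bigD1 (inord j)) //= big1 => [|k /negPf kE].
    rewrite mxE /= inordK ?eqxx ?mulr1n ?addr0; last by rewrite ltnS ltnW.
    rewrite -e1 rmorphM mulrC -[in LHS]hsigma !mxE; congr (_ * _).
    by apply/esym/CrealP/complex_realP; exists (ladder_coef R n j.+1).
  rewrite mxE /= eqSS; move: kE; rewrite -val_eqE /= inordK => [->|]; last by rewrite ltnS ltnW.
  by rewrite mulr0n mulr0.
rewrite -norm_conjC -tr1 -tr2 /variance.
have rX : \tr (rho *m X) \is Num.real by apply: mxtrace_hermsym_real.
have rY : \tr (rho *m Y) \is Num.real by apply: mxtrace_hermsym_real.
have -> : \tr (rho *m Lp) = \tr (rho *m X) + 'i%C * \tr (rho *m Y).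
  by rewrite mulmxDr -scalemxAr mxtraceD mxtraceZ.
rewrite normCK rmorphD rmorphM /= conji (CrealP rX) (CrealP rY) mulmxDr mxtraceD.
rewrite -![rho * _]/(rho *m _) !expr2.
set x := \tr (rho *m X); set y := \tr (rho *m Y).
have -> : (x + 'i%C * y) * (x + - 'i%C * y) = x * x - ('i%C * 'i%C) * (y * y) by ring.
by rewrite mulii; ring.
Qed.

End Ladder.

(** * Density matrices: unitary conjugation, pure states, principal minors *)

Section Density.
Variables (R : realType) (n : nat).
Local Notation C := R[i].

Lemma density_conjmx (P rho : 'M[C]_n) :
  P ^t* *m P = 1%:M -> density rho -> density (P ^t* *m rho *m P).
Proof.
move=> P1 [/hermsymmxP hrho prho trho]; split.
- by apply/hermsymmxP; rewrite !adjmxM trmxCK hrho mulmxA.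
- by move=> v; have := prho (P *m v); rewrite adjmxM !mulmxA.
by rewrite mxtrace_mulC mulmxA (mulmx1C P1) mul1mx.
Qed.

Lemma density_rank1 (u : 'cV[C]_n) : u ^t* *m u = 1%:M -> density (u *m u ^t*).
Proof.
move=> u1; split.
- by apply/hermsymmxP; rewrite adjmxM trmxCK.
- move=> v; have := adjmx_mul_ge0 (u ^t* *m v).
  by rewrite adjmxM trmxCK !mulmxA.
by rewrite mxtrace_mulC u1 mxtrace1.
Qed.

Lemma density_entry (rho : 'M[C]_n) i j (x y : C) : density rho ->
  0 <= x^*%R * x * rho i i + x^*%R * y * rho i j + y^*%R * x * rho j i + y^*%R * y * rho j j.
Proof.
by case=> _ prho _; have := prho (x *: delta_mx i 0 + y *: delta_mx j 0); rewrite sesqui_delta.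
Qed.

Lemma density_diag_ge0 (rho : 'M[C]_n) i : density rho -> 0 <= rho i i.
Proof.
by move=> /(@density_entry _ i i 1 0); rewrite !(rmorph0, rmorph1, mul0r, mul1r, mulr0, addr0).
Qed.

(** Suitable test vectors give the 2 x 2 minor multiplied by [rho j j] ([Hj]) or by [rho i i]
    ([Hi]), which settles the case of a nonzero diagonal entry. When both vanish, [H0] forces
    [rho i j] to be 0. *)
Lemma density_offdiag_le (rho : 'M[C]_n) i j : density rho ->
  `|rho i j| ^+ 2 <= rho i i * rho j j.
Proof.
move=> drho; have di := density_diag_ge0 i drho; have dj := density_diag_ge0 j drho.
have [/hermsymmxP hrho _ _] := drho.
have jiE : rho j i = (rho i j)^*%R by rewrite -[in LHS]hrho !mxE.
have conjd k : 0 <= rho k k -> (rho k k)^*%R = rho k k by move/ger0_real/CrealP.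
have Hj : 0 <= rho j j * (rho i i * rho j j - `|rho i j| ^+ 2).
  have := density_entry i j (rho j j) (- rho j i) drho.
  rewrite rmorphN /= conjd // jiE conjCK normCK; congr (0 <= _); ring.
have Hi : 0 <= rho i i * (rho i i * rho j j - `|rho i j| ^+ 2).
  have := density_entry i j (- rho i j) (rho i i) drho.
  rewrite rmorphN /= conjd // jiE normCK; congr (0 <= _); ring.
have H0 : 0 <= rho i i + rho j j * `|rho i j| ^+ 2 - 2 * `|rho i j| ^+ 2.
  have := density_entry i j 1 (- rho j i) drho.
  rewrite rmorphN rmorph1 /= jiE conjCK normCK; congr (0 <= _); ring.
rewrite -subr_ge0.
have [i0|i0] := eqVneq (rho i i) 0; last by rewrite -(pmulr_rge0 _ (_ : 0 < rho i i)) // lt_def i0.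
have [j0|j0] := eqVneq (rho j j) 0; last by rewrite -(pmulr_rge0 _ (_ : 0 < rho j j)) // lt_def j0.
rewrite i0 mul0r sub0r -(pmulr_rge0 _ (_ : 0 < 2)) // mulrN.
by move: H0; rewrite i0 j0 mul0r !add0r.
Qed.

End Density.

(** * Reduction to a minimum over real unit vectors *)

Section Reduction.
Variables (R : realType) (n : nat).
Local Notation C := R[i].

(** The commutation relations are invariant under cyclic relabelling, so [L3], [L1], [L2] can play
    the roles of [X], [Y], [Z]. *)
Lemma spin_rep_variance (L1 L2 L3 : 'M[C]_n.+1) : spin_rep L1 L2 L3 ->
  exists2 P : 'M[C]_n.+1, P ^t* *m P = 1%:M &
  forall rho : 'M[C]_n.+1, rho ^t* = rho ->
  let sigma := P ^t* *m rho *m P in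
  variance rho L1 + variance rho L3 =
    \sum_(j < n.+1) (planar_weight R n j)%:C * sigma j j
      - `|\sum_(j < n) (ladder_coef R n j.+1)%:C * sigma (inord j) (inord j.+1)| ^+ 2.
Proof.
move=> [/hermsymmxP h1 /hermsymmxP h2 /hermsymmxP h3 c12 c23 c31 cas _].
have cas' : L3 ^+ 2 + L1 ^+ 2 + L2 ^+ 2 = ((spin R n)%:C * ((spin R n)%:C + 1))%:M.
  by rewrite -addrA addrC cas rmorphM rmorphD rmorph1.
have [P [P1 ZP LpP]] := weight_basis h3 h1 h2 c31 c12 c23 cas'.
exists P => // rho hrho sigma; rewrite addrC.
exact: planar_variance_weight_basis ZP LpP hrho.
Qed.

Lemma planar_energy_le (sigma : 'M[C]_n.+1) : density sigma ->
  exists2 x : nat -> R,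
    (forall j, 0 <= x j) /\ \sum_(j < n.+1) x j ^+ 2 = 1 &
    (planar_energy n x)%:C <= \sum_(j < n.+1) (planar_weight R n j)%:C * sigma j j
      - `|\sum_(j < n) (ladder_coef R n j.+1)%:C * sigma (inord j) (inord j.+1)| ^+ 2.
Proof.
move=> dsigma; pose x j : R := Num.sqrt (complex.Re (sigma (inord j) (inord j))).
have xE j : (x j)%:C ^+ 2 = sigma (inord j) (inord j).
  have := density_diag_ge0 (inord j) dsigma; rewrite /x.
  case: (sigma _ _) => a b; rewrite lecE /= => /andP[/eqP -> a0].
  by rewrite -rmorphXn /= sqr_sqrtr.
have xEo (j : 'I_n.+1) : (x j)%:C ^+ 2 = sigma j j by rewrite xE inord_val.
have x0 j : 0 <= x j by apply: sqrtr_ge0.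
exists x; first split=> //.
  apply: complexI; rewrite rmorph_sum rmorph1; case: dsigma => _ _ <-.
  by apply: eq_bigr => j _; rewrite rmorphXn -xEo.
rewrite /planar_energy rmorphB rmorph_sum; apply: lerB.
  by apply: ler_sum => j _; rewrite rmorphM rmorphXn /= xEo.
rewrite rmorphXn /= ler_pXn2r ?nnegrE ?normr_ge0 //; last first.
  by rewrite ler0c sumr_ge0 // => j _; rewrite !mulr_ge0 // sqrtr_ge0.
(* After the triangle inequality, each off-diagonal modulus is at most the product of the two
   neighbouring amplitudes. *)
rewrite (le_trans (ler_norm_sum _ _ _)) // rmorph_sum ler_sum // => j _.
rewrite normrM !rmorphM ger0_norm ?ler0c ?sqrtr_ge0 // ler_wpM2l ?ler0c ?sqrtr_ge0 //.
rewrite -(@ler_pXn2r _ 2) ?nnegrE ?normr_ge0 ?mulr_ge0 ?ler0c //.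
by rewrite exprMn !xE density_offdiag_le.
Qed.

(** The lower bound concerns nonnegative amplitudes, as produced by [planar_energy_le]. For
    optimality any real unit vector will do, since the energy of [x] is the sum of the variances in
    the pure state that [P] maps it to. *)
Lemma c2_is_min (c : R) :
  (forall x : nat -> R, (forall j, 0 <= x j) -> \sum_(j < n.+1) x j ^+ 2 = 1 ->
     c <= planar_energy n x) ->
  (exists2 x : nat -> R, \sum_(j < n.+1) x j ^+ 2 = 1 & planar_energy n x <= c) ->
  c2_is n c.
Proof.
move=> lb [x x1 xc] L1 L2 L3 rep; have [P P1 varE] := spin_rep_variance rep; split.
  move=> rho drho; have [/hermsymmxP hrho _ _] := drho.
  have [y [y0 y1] yle] := planar_energy_le (density_conjmx P1 drho).
  by rewrite varE // (le_trans _ yle) // lecR lb.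
move=> c' H; rewrite (le_trans _ xc) // -lecR.
pose w : 'cV[C]_n.+1 := \col_j (x j)%:C.
have wE : w ^t* *m w = 1%:M.
  apply/matrixP => i j; rewrite !ord1 !mxE mulr1n -(rmorph1 (real_complex R)) -x1 rmorph_sum.
  apply: eq_bigr => k _; rewrite !mxE rmorphXn expr2; congr (_ * _).
  by apply/CrealP/complex_realP; exists (x k).
have uE : (P *m w) ^t* *m (P *m w) = 1%:M.
  by rewrite adjmxM mulmxA -(mulmxA (w ^t*)) P1 mulmx1.
have drho := density_rank1 uE; have [/hermsymmxP hrho _ _] := drho.
rewrite (le_trans (H _ drho)) // varE //.
have -> : P ^t* *m (P *m w *m (P *m w) ^t*) *m P = w *m w ^t*.
  by rewrite adjmxM !mulmxA P1 mul1mx -mulmxA P1 mulmx1.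
have sE i j : (w *m w ^t*) i j = (x i * x j)%:C.
  rewrite mxE big_ord1 !mxE rmorphM; congr (_ * _).
  by apply/CrealP/complex_realP; exists (x j).
rewrite /planar_energy rmorphB rmorphXn /= !rmorph_sum lerB //.
  by apply: ler_sum => j _; rewrite sE expr2 -rmorphM.
have -> : \sum_(j < n) (ladder_coef R n j.+1)%:C * (w *m w ^t*) (inord j) (inord j.+1) =
    (\sum_(j < n) ladder_coef R n j.+1 * (x j * x j.+1))%:C.
  rewrite rmorph_sum; apply: eq_bigr => j _.
  by rewrite sE !inordK ?ltnS ?(ltnW (ltn_ord j)) // [RHS]rmorphM.
rewrite -rmorph_sum -normrX ger0_norm //.
by rewrite -rmorphXn ler0c sqr_ge0.
Qed.

End Reduction.

(** * The minima for spins 1/2, 1 and 3/2 *)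

Section Values.
Variable R : realType.
Implicit Types (x : nat -> R) (y z r l g : R).

Lemma c2_half : c2_is 1 (1 / 4 : R).
Proof.
have E x : planar_energy 1 x = (x 0%N ^+ 2 + x 1%N ^+ 2) / 2 - (x 0%N * x 1%N) ^+ 2.
  rewrite /planar_energy /planar_weight /ladder_coef !big_ord_recr !big_ord0 /=.
  by rewrite sqrtr1; field.
apply: c2_is_min => [x _|].
  rewrite E !big_ord_recr big_ord0 /= add0r => H.
  rewrite exprMn; set p := x 0%N ^+ 2 in H *; set q := x 1%N ^+ 2 in H *.
  have -> : q = 1 - p by lra.
  (* The energy is 1/4 + (p - 1/2)^2. *)
  by have := sqr_ge0 (p - 1 / 2); lra.
exists (fun=> Num.sqrt (1 / 2)).
  by rewrite !big_ord_recr big_ord0 /= sqr_sqrtr; lra.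
by rewrite E /= exprMn sqr_sqrtr; lra.
Qed.

(** With p = x_1^2, the energy on the unit sphere is 7/16 + (2 p - 3/4)^2 + 2 p (x_0 - x_2)^2. It is
    minimal at p = 3/8 and x_0 = x_2, whence x_0^2 = 5/16. *)
Lemma c2_one : c2_is 2 (7 / 16 : R).
Proof.
have E x : planar_energy 2 x = x 0%N ^+ 2 + 2 * x 1%N ^+ 2 + x 2%N ^+ 2
    - 2 * (x 1%N ^+ 2 * (x 0%N + x 2%N) ^+ 2).
  have c1 : ladder_coef R 2 1 = Num.sqrt 2 by [].
  have c2 : ladder_coef R 2 2 = Num.sqrt 2 by [].
  rewrite /planar_energy /planar_weight !big_ord_recr !big_ord0 /= c1 c2.
  have s2 : Num.sqrt 2 ^+ 2 = 2 :> R by rewrite sqr_sqrtr.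
  by rewrite -[X in _ = _ - X * (_ * _)]s2; field.
apply: c2_is_min => [x _|].
  rewrite E !big_ord_recr big_ord0 /= add0r => H.
  set p := x 1%N ^+ 2 in H *; have p0 : 0 <= p := sqr_ge0 _.
  have : 0 <= p * (x 0%N - x 2%N) ^+ 2 by rewrite mulr_ge0 ?sqr_ge0.
  have : 0 <= (2 * p - 3 / 4) ^+ 2 by rewrite sqr_ge0.
  have -> : x 0%N ^+ 2 = 1 - p - x 2%N ^+ 2 by lra.
  have -> : (x 0%N + x 2%N) ^+ 2 = 2 * (1 - p) - (x 0%N - x 2%N) ^+ 2.
    rewrite (_ : 1 - p = x 0%N ^+ 2 + x 2%N ^+ 2); [ring|lra].
  by move=> *; lra.
exists (fun j => Num.sqrt (if j == 1%N then 3 / 8 else 5 / 16)).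
  by rewrite !big_ord_recr big_ord0 /= !sqr_sqrtr; lra.
rewrite E /=; set u := Num.sqrt (3 / 8); set v := Num.sqrt (5 / 16).
rewrite (_ : (v + v) ^+ 2 = 4 * v ^+ 2); last by ring.
by rewrite !sqr_sqrtr; lra.
Qed.

(* [g] stands for cos (pi / 9), whose minimal polynomial is 8 X^3 - 6 X - 1,
   and [r] for the square root of 3. *)
Section ThreeHalves.
Variables (g r : R).
Hypotheses (g0 : 0 < g) (g1 : g <= 1) (gE : 8 * g ^+ 3 - 6 * g - 1 = 0).
Hypotheses (r0 : 0 <= r) (rE : r ^+ 2 = 3).

Let c := 1 / 4 + g ^+ 2 - (2 * g)^-1.
(** Put M = r y z + z^2. For y^2 + z^2 = 1, the form A1 y^2 + A2 z^2 - 2 l r y z is 3/2 y^2 + 7/2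
    z^2 - M^2 - c with -M^2 replaced by l^2 - 2 l M. This replacement is an upper bound, with
    equality at l = M. *)
Let A1 l := 3 / 2 + l ^+ 2 - c.
Let A2 l := 7 / 2 - 2 * l + l ^+ 2 - c.

(** The radicand is a perfect square modulo the cubic equation of [g]. *)
Lemma sqrt_three_halves : Num.sqrt (4 * g ^+ 2 + 2 * g + 1) = 2 + (2 * g)^-1.
Proof.
have i0 : 0 < g^-1 by rewrite invr_gt0.
have -> : 4 * g ^+ 2 + 2 * g + 1 = (2 + (2 * g)^-1) ^+ 2.
  apply/eqP; rewrite -subr_eq0; apply/eqP.
  have -> : 4 * g ^+ 2 + 2 * g + 1 - (2 + (2 * g)^-1) ^+ 2 =
      (8 * g ^+ 3 - 6 * g - 1) * (2 * g + 1) / (4 * g ^+ 2).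
    by field; rewrite gt_eqF.
  by rewrite gE !mul0r.
by rewrite sqrtr_sqr ger0_norm // addr_ge0 // invr_ge0 mulr_ge0 // ltW.
Qed.

Lemma A1_gt0 l : 0 < A1 l.
Proof.
have : 0 < (2 * g)^-1 by rewrite invr_gt0 mulr_gt0.
have : 0 <= l ^+ 2 := sqr_ge0 _.
have : g ^+ 2 <= 1 by rewrite expr_le1 // ltW.
by rewrite /A1 /c; lra.
Qed.

Lemma form_detE l :
  A1 l * A2 l - 3 * l ^+ 2 = (l - 1 / 2 - g) ^+ 2 * ((l - 1 / 2 + g) ^+ 2 + g^-1).
Proof.
apply/eqP; rewrite -subr_eq0; apply/eqP.
have -> : A1 l * A2 l - 3 * l ^+ 2
    - (l - 1 / 2 - g) ^+ 2 * ((l - 1 / 2 + g) ^+ 2 + g^-1) =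
    - (8 * g ^+ 3 - 6 * g - 1) * (2 * g + 1) / (4 * g ^+ 2).
  by rewrite /A1 /A2 /c; field; rewrite gt_eqF.
by rewrite gE oppr0 !mul0r.
Qed.

(** Completing the square in y leaves the determinant of the form times z^2. *)
Lemma formE l y z :
  A1 l * (A1 l * y ^+ 2 + A2 l * z ^+ 2 - 2 * l * r * y * z) =
  (A1 l * y - l * r * z) ^+ 2
    + (l - 1 / 2 - g) ^+ 2 * ((l - 1 / 2 + g) ^+ 2 + g^-1) * z ^+ 2.
Proof. by rewrite -form_detE -rE; ring. Qed.

Lemma form_ge0 l y z : 0 <= A1 l * y ^+ 2 + A2 l * z ^+ 2 - 2 * l * r * y * z.
Proof.
rewrite -(pmulr_rge0 _ (A1_gt0 l)) formE addr_ge0 ?sqr_ge0 //.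
rewrite mulr_ge0 ?sqr_ge0 // mulr_ge0 ?sqr_ge0 // addr_ge0 ?sqr_ge0 //.
by rewrite invr_ge0 ltW.
Qed.

Lemma planar_energy3E x : r = Num.sqrt 3 ->
  planar_energy 3 x = 3 / 2 * (x 0%N ^+ 2 + x 3%N ^+ 2) + 7 / 2 * (x 1%N ^+ 2 + x 2%N ^+ 2)
    - (r * (x 0%N * x 1%N + x 2%N * x 3%N) + 2 * (x 1%N * x 2%N)) ^+ 2.
Proof.
move=> rdef.
have c1 : ladder_coef R 3 1 = r by rewrite rdef.
have c2 : ladder_coef R 3 2 = 2.
  by rewrite /ladder_coef natrM -expr2 sqrtr_sqr ger0_norm.
have c3 : ladder_coef R 3 3 = r by rewrite rdef.
rewrite /planar_energy /planar_weight !big_ord_recr !big_ord0 /= c1 c2 c3.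
by field.
Qed.

Lemma c2_three_halves_aux : r = Num.sqrt 3 -> c2_is 3 c.
Proof.
move=> rdef; apply: c2_is_min => [x x0|].
  rewrite planar_energy3E // !big_ord_recr big_ord0 /= add0r => H.
  set T := r * _ + _.
  have T0 : 0 <= T by rewrite !(addr_ge0, mulr_ge0).
  (* Only the norms of the outer and the inner pair of amplitudes are kept. *)
  pose y := Num.sqrt (x 0%N ^+ 2 + x 3%N ^+ 2).
  pose z := Num.sqrt (x 1%N ^+ 2 + x 2%N ^+ 2).
  have yE : y ^+ 2 = x 0%N ^+ 2 + x 3%N ^+ 2 by rewrite sqr_sqrtr // addr_ge0 ?sqr_ge0.
  have zE : z ^+ 2 = x 1%N ^+ 2 + x 2%N ^+ 2 by rewrite sqr_sqrtr // addr_ge0 ?sqr_ge0.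
  have y0 : 0 <= y := sqrtr_ge0 _.
  have z0 : 0 <= z := sqrtr_ge0 _.
  have yz1 : y ^+ 2 + z ^+ 2 = 1 by lra.
  (* Cauchy-Schwarz bounds the first term, and 2 x_1 x_2 <= x_1^2 + x_2^2 the second. *)
  have TM : T <= r * (y * z) + z ^+ 2.
    apply: lerD.
      rewrite ler_wpM2l // -(@ler_pXn2r _ 2) ?nnegrE ?addr_ge0 ?mulr_ge0 //.
      rewrite exprMn yE zE -subr_ge0.
      have -> : (x 0%N ^+ 2 + x 3%N ^+ 2) * (x 1%N ^+ 2 + x 2%N ^+ 2)
          - (x 0%N * x 1%N + x 2%N * x 3%N) ^+ 2 = (x 0%N * x 2%N - x 1%N * x 3%N) ^+ 2.
        by ring.
      exact: sqr_ge0.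
    by have := sqr_ge0 (x 1%N - x 2%N); rewrite zE; lra.
  set M := r * (y * z) + z ^+ 2 in TM.
  have : T ^+ 2 <= M ^+ 2 by rewrite ler_pXn2r ?nnegrE // (le_trans T0).
  have := form_ge0 M y z.
  have -> : A1 M * y ^+ 2 + A2 M * z ^+ 2 - 2 * M * r * y * z =
      3 / 2 * y ^+ 2 + 7 / 2 * z ^+ 2 + (M ^+ 2 - c) * (y ^+ 2 + z ^+ 2)
        - 2 * M * (r * (y * z) + z ^+ 2).
    by rewrite /A1 /A2; ring.
  by rewrite -/M yz1 yE zE; lra.
(* At l = g + 1/2 the form is degenerate, with kernel spanned by (l r, A1 l). *)
pose l := g + 1 / 2; pose N := 2 * ((l * r) ^+ 2 + A1 l ^+ 2).
have N0 : 0 < N.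
  by rewrite mulr_gt0 // ltr_wpDl ?sqr_ge0 // exprn_gt0 // A1_gt0.
pose y := l * r / Num.sqrt N; pose z := A1 l / Num.sqrt N.
(* The witness is (y, z, z, y), in which each value occurs twice; this symmetry gives equality in
   both bounds on T. *)
have yz1 : 2 * (y ^+ 2 + z ^+ 2) = 1.
  rewrite /y /z ![(_ / _) ^+ 2]exprMn exprVn sqr_sqrtr ?ltW // -mulrDl mulrA -/N.
  by rewrite divff // gt_eqF.
have form0 : A1 l * y ^+ 2 + A2 l * z ^+ 2 - 2 * l * r * y * z = 0.
  apply: (mulfI (lt0r_neq0 (A1_gt0 l))); rewrite formE mulr0.
  have -> : l - 1 / 2 - g = 0 by rewrite /l; ring.
  have -> : A1 l * y - l * r * z = 0 by rewrite /y /z; ring.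
  by rewrite expr0n /= !mul0r addr0.
exists (fun j => if (j == 1%N) || (j == 2%N) then z else y).
  by rewrite !big_ord_recr big_ord0 /=; lra.
rewrite planar_energy3E //=.
have H : 3 * y ^+ 2 + 7 * z ^+ 2 + (l ^+ 2 - c) * (2 * (y ^+ 2 + z ^+ 2))
    - 2 * l * (2 * (r * (y * z) + z ^+ 2)) = 0.
  by move: form0; rewrite /A1 /A2; lra.
(* With T the raising sum of the witness, T^2 >= 2 l T - l^2 turns the vanishing of the form into
   energy at most [c]. *)
have := sqr_ge0 (2 * (r * (y * z) + z ^+ 2) - l).
have -> : r * (y * z + z * y) + 2 * (z * z) = 2 * (r * (y * z) + z ^+ 2) by ring.
by move: H; rewrite yz1; set T := 2 * (_ + _); lra.
Qed.

End ThreeHalves.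

(** * Trigonometry: the cubic equation of cos (pi / 9) *)

Lemma cos_mulr3n (t : R) : cos (t *+ 3) = 4 * cos t ^+ 3 - 3 * cos t.
Proof.
rewrite mulrS cosD cos_mulr2n sin_mulr2n -mulrnAl.
have -> : sin t * (cos t *+ 2 * sin t) = 2 * cos t * sin t ^+ 2 by ring.
by rewrite sin2cos2; ring.
Qed.

Lemma cos_pi_gt0 (k : nat) : (2 < k)%N -> 0 < cos (pi / k%:R : R).
Proof.
move=> k2; apply: cos_gt0_pihalf; have p0 := @pi_gt0 R.
have k0 : 0 < k%:R :> R by rewrite ltr0n; lia.
have q0 : 0 < pi / k%:R :> R by rewrite divr_gt0.
apply/andP; split; first by rewrite (lt_trans _ q0) // oppr_lt0 divr_gt0.
by rewrite ltr_pM2l // ltf_pV2 ?posrE // ltr_nat.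
Qed.

(** Tripling the angle gives 4 u^3 - 3 u + 1 = (u + 1) (2 u - 1)^2 = 0, and positivity of u excludes
    the root -1. *)
Lemma cos_pi3 : cos (pi / 3) = 1 / 2 :> R.
Proof.
have := cos_mulr3n (pi / 3).
have -> : pi / 3 *+ 3 = pi :> R by field.
rewrite cospi.
have := @cos_pi_gt0 3 isT; set u := cos _ => u0 /eqP.
rewrite -subr_eq0 (_ : _ - _ = - ((u + 1) * (2 * u - 1) ^+ 2)); last by ring.
by rewrite oppr_eq0 mulf_eq0 expf_eq0 /= => /orP[] /eqP; lra.
Qed.

Lemma cos_pi9_root : 8 * cos (pi / 9) ^+ 3 - 6 * cos (pi / 9) - 1 = 0 :> R.
Proof.
have := cos_mulr3n (pi / 9).
have -> : pi / 9 *+ 3 = pi / 3 :> R by field.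
by rewrite cos_pi3 => H; lra.
Qed.

End Values.

Theorem mainTheorem2 (R : realType) :
  let gamma : R := cos (pi / 9) in
  [/\ c2_is 1 (1 / 4 : R),
      c2_is 2 (7 / 16 : R)
    & c2_is 3 (9 / 4 + gamma ^+ 2
               - Num.sqrt (4 * gamma ^+ 2 + 2 * gamma + 1))].
Proof.
move=> gamma; split; [exact: c2_half|exact: c2_one|].
have g0 : 0 < gamma by apply: (@cos_pi_gt0 R 9).
have g1 : gamma <= 1 by apply: cos_le1.
have gE : 8 * gamma ^+ 3 - 6 * gamma - 1 = 0 := cos_pi9_root R.
rewrite (sqrt_three_halves g0 gE).
have -> : 9 / 4 + gamma ^+ 2 - (2 + (2 * gamma)^-1) = 1 / 4 + gamma ^+ 2 - (2 * gamma)^-1.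
  by field; rewrite gt_eqF.
apply: c2_three_halves_aux g0 g1 gE _ _ (erefl (Num.sqrt 3)); first exact: sqrtr_ge0.
by rewrite sqr_sqrtr.
Qed.
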